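(* Let $G_1$ and $G_2$ be two connected graphs, each with $n$ vertices and $m$ edges, having Laplacian spectra $0=\mu_n<\mu_{n-1}\leq\cdots\leq\mu_1$ and $0=\lambda_n<\lambda_{n-1}\leq\cdots\leq\lambda_1$, respectively. Let $p>n$ be a positive integer such that $$\frac{2m}{p+n}<\min(\mu_{n-1},\lambda_{n-1}).$$ Then $LE(\tilde{G_1})=LE(\tilde{G_2})$, where $\tilde{G_i}=(G_i\cup\overline{K_p})\times K_p$ for $i=1,2$.
   Context: All graphs are finite, undirected and simple. For a graph $G$ with $N$ vertices and $M$ edges, adjacency matrix $A(G)$ and diagonal degree matrix $D(G)$, the Laplacian matrix is $L(G)=D(G)-A(G)$; its eigenvalues with multiplicity, $\mu_1,\dots,\mu_N$, form the Laplacian spectrum of $G$. The Laplacian energy is $LE(G)=\sum_{i=1}^{N}\left|\mu_i-\frac{2M}{N}\right|$. $K_p$ is the complete graph on $p$ vertices, $\overline{K_p}$ the graph on $p$ vertices with no edges, and $G\cup H$ the disjoint union. $G\times H$ is the Cartesian product: vertex set $V(G)\times V(H)$, with $(u_1,v_1)$ adjacent to $(u_2,v_2)$ iff either $u_1=u_2$ and $v_1v_2\in E(H)$, or $v_1=v_2$ and $u_1u_2\in E(G)$. Writing $\mu_{n-1}$ presupposes $n\ge 2$. *)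

(* Defs.v *)
From HB Require Import structures.
From mathcomp Require Import all_boot all_order all_algebra.
From mathcomp Require Import polyrcf complex.

Set Implicit Arguments.
Unset Strict Implicit.
Unset Printing Implicit Defensive.

Import Order.TTheory GRing.Theory Num.Theory.
Local Open Scope ring_scope.

Record sgraph := SGraph {
  vertex :> finType;
  edge : rel vertex;
  edge_sym : symmetric edge;
  edge_irr : irreflexive edge
}.

Definition edges (G : sgraph) : {set {set G}} :=
  [set [set u.1; u.2] | u : G * G & edge u.1 u.2].

Definition degree (G : sgraph) (x : G) : nat := #|[set y | edge x y]|.

Definition connected (G : sgraph) : Prop :=
  (0 < #|G|)%N /\ forall x y : G, connect (@edge G) x y.

Fact complete_sym (p : nat) : symmetric (fun x y : 'I_p => x != y).
Proof. by move=> x y; rewrite eq_sym. Qed.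
Fact complete_irr (p : nat) : irreflexive (fun x y : 'I_p => x != y).
Proof. by move=> x; rewrite eqxx. Qed.
Definition complete (p : nat) : sgraph :=
  SGraph (@complete_sym p) (@complete_irr p).

Definition edgeless (p : nat) : sgraph :=
  @SGraph 'I_p (fun _ _ => false) (fun _ _ => erefl) (fun _ => erefl).

Section Operations.
Variables G H : sgraph.

Definition dunion_rel : rel (G + H) := fun u v =>
  match u, v with
  | inl x, inl y => edge x y
  | inr x, inr y => edge x y
  | _, _ => false
  end.
Fact dunion_sym : symmetric dunion_rel.
Proof. by move=> [x|x] [y|y] //=; rewrite edge_sym. Qed.
Fact dunion_irr : irreflexive dunion_rel.
Proof. by move=> [x|x] /=; rewrite edge_irr. Qed.
Definition dunion : sgraph := SGraph dunion_sym dunion_irr.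

Definition cartesian_rel : rel (G * H) := fun u v =>
  ((u.1 == v.1) && edge u.2 v.2) || ((u.2 == v.2) && edge u.1 v.1).
Fact cartesian_sym : symmetric cartesian_rel.
Proof.
move=> u v; rewrite /cartesian_rel.
by rewrite (eq_sym v.1) (eq_sym v.2) (edge_sym v.1) (edge_sym v.2).
Qed.
Fact cartesian_irr : irreflexive cartesian_rel.
Proof. by move=> u; rewrite /cartesian_rel !edge_irr !andbF. Qed.
Definition cartesian : sgraph := SGraph cartesian_sym cartesian_irr.

End Operations.

Section Laplacian.
Variables (R : rcfType) (G : sgraph).

(* Rows and columns are indexed by the enumeration of the vertices. *)
Definition adjacency_mx : 'M[R]_#|G| :=
  \matrix_(i, j) (edge (enum_val i) (enum_val j))%:R.

Definition degree_mx : 'M[R]_#|G| :=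
  diag_mx (\row_i (degree (enum_val i))%:R).

Definition laplacian_mx : 'M[R]_#|G| := degree_mx - adjacency_mx.

(* The roots of the characteristic polynomial, repeated according to           *)
(* multiplicity and listed in nonincreasing order. No eigenvalue is lost by    *)
(* taking roots in R only: see char_poly_laplacian.                            *)
Definition laplacian_spectrum : seq R :=
  let P := char_poly laplacian_mx in
  sort >=%R (flatten [seq nseq (mup x P) x | x <- rootsR P]).

(* The k-th largest eigenvalue, counted from k = 1. *)
Definition laplacian_eig (k : nat) : R := nth 0 laplacian_spectrum k.-1.

Definition laplacian_energy : R :=
  \sum_(x <- laplacian_spectrum) `|x - (2 * #|edges G|)%:R / #|G|%:R|.

End Laplacian.

Lemma laplacian_mx_sym (R : rcfType) (G : sgraph) :
  (laplacian_mx R G)^T = laplacian_mx R G.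
Proof.
rewrite /laplacian_mx linearB /= tr_diag_mx; congr (_ - _).
by apply/matrixP=> i j; rewrite !mxE edge_sym.
Qed.

Lemma char_poly_conj (F : fieldType) (n : nat) (A V : 'M[F]_n) :
  V \in unitmx -> char_poly (invmx V *m A *m V) = char_poly A.
Proof.
move=> Vu; pose g : {rmorphism F -> {poly F}} := polyC.
have VV : map_mx g (invmx V) *m map_mx g V = 1%:M.
  by rewrite -map_mxM mulVmx // map_mx1.
rewrite /char_poly /char_poly_mx !map_mxM.
have -> : 'X%:M - map_mx g (invmx V) *m map_mx g A *m map_mx g V =
    map_mx g (invmx V) *m ('X%:M - map_mx g A) *m map_mx g V.
  by rewrite mulmxBr mulmxBl scalar_mxC -[in RHS](mulmxA 'X%:M) VV mulmx1.
by rewrite !det_mulmx mulrAC -det_mulmx VV det1 mul1r.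
Qed.

Lemma char_poly_symmetric_split (R : rcfType) (n : nat) (A : 'M[R]_n) :
  A^T = A -> exists s : seq R, char_poly A = \prod_(x <- s) ('X - x%:P).
Proof.
move=> Asym; pose f := real_complex R; pose B := map_mx f A.
have Bherm : B \is hermsymmx.
  apply: realsym_hermsym.
    by apply/is_hermitianmxP; rewrite expr0 scale1r map_mx_id // /B map_trmx Asym.
  by apply/mxOverP=> i j; rewrite mxE; apply/complex_realP; exists (A i j).
have [/orthomx_spectralP Beq Dreal] :=
  (hermitian_normalmx Bherm, hermitian_spectral_diag_real Bherm).
set d := spectral_diag B in Beq Dreal.
have dE j : exists r : R, d 0 j == f r.
  by have /mxOverP/(_ 0 j)/complex_realP[r ->] := Dreal; exists r.
exists [seq xchoose (dE j) | j <- enum 'I_n].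
apply: (map_poly_inj f); rewrite map_char_poly -/B Beq.
rewrite (char_poly_conj _ (spectral_unit _)).
rewrite char_poly_trig ?diag_mx_is_trig // rmorph_prod big_map big_enum /=.
apply: eq_bigr => j _; rewrite rmorphB /= map_polyX map_polyC /=.
by congr (_ - _%:P); rewrite mxE eqxx mulr1n; apply/eqP/(xchooseP (dE j)).
Qed.

Lemma perm_laplacian_spectrum (R : rcfType) (G : sgraph) (s : seq R) :
  char_poly (laplacian_mx R G) = \prod_(x <- s) ('X - x%:P) ->
  perm_eq (laplacian_spectrum R G) s.
Proof.
move=> Ps; rewrite /laplacian_spectrum perm_sort Ps.
set P := \prod_(x <- s) _.
have P0 : P != 0 by rewrite monic_neq0 ?monic_prod_XsubC.
apply/allP=> x _ /=; apply/eqP.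
rewrite count_flatten -map_comp.
rewrite (eq_map (g := fun y => (y == x) * mup x P)%N); last first.
  by move=> y; rewrite /= count_nseq /=; case: eqP => // ->.
rewrite sumnE big_map -big_distrl /= -big_mkcond /= sum1_count.
rewrite count_uniq_mem ?uniq_roots // -(mu_prod_XsubC x s) -/P.
have := roots_on_rootsR P0 x; rewrite in_itv /= => <-.
by case: (boolP (root P x)) => [|/mupNroot ->]; rewrite ?mul1n ?muln0.
Qed.

Lemma char_poly_laplacian (R : rcfType) (G : sgraph) :
  char_poly (laplacian_mx R G) =
  \prod_(x <- laplacian_spectrum R G) ('X - x%:P).
Proof.
have [s Ps] := char_poly_symmetric_split (laplacian_mx_sym R G).
by rewrite Ps; apply/perm_big; rewrite perm_sym; apply: perm_laplacian_spectrum.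
Qed.

(* Main.v *)
(* Tensoring eigenvectors, the Laplacian eigenvalues of (G + H) x K are the    *)
(* sums of an eigenvalue of G or H and one of K, so that for fixed H and K the *)
(* energy depends on G only through the inner sums over the spectrum of G.     *)
(* For K = K_p the shifts are 0 or p, whatever their multiplicities, and the   *)
(* mean degree is a = 2m/(p+n) + p - 1.  With shift 0, every eigenvalue x of G *)
(* satisfies x <= n <= a; with shift p, x + p - a = x + 1 - 2m/(p+n) is        *)
(* positive for all x but the least, which is 0.  Either way the sum of        *)
(* absolute values is determined by n, p and the trace 2m.                     *)
Require Import Defs.
From mathcomp Require Import all_boot all_order all_algebra.
From mathcomp Require Import complex ring lra.
Import Order.TTheory GRing.Theory Num.Theory.
Local Open Scope ring_scope.

Set Implicit Arguments.
Unset Strict Implicit.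
Unset Printing Implicit Defensive.

(** The energy of [(G + H) x K] is a double sum over eigenvalues in which [G] enters only through
    sums of distances from its spectrum to certain points ([energy_cartesian_dunion]). With [K]
    complete there are two such points ([spectrum_complete]). One lies at or above every eigenvalue
    of [G] ([spectrum_le_card]), the other below every eigenvalue except one 0 ([spectrum_rcons]).
    So all signs are known, apart from a term that depends only on the point. By the trace formula
    [sum_spectrum], only the vertex and edge counts remain ([sum_dist_spectrum_above],
    [sum_dist_spectrum_gap]), and [G1] and [G2] share these. *)

(** * Matrices indexed by a finite type *)

Section FunctionMatrices.
Variables (F : fieldType) (T : finType).

(** Entries are addressed by elements of [T], so that sums over [G + H] and [G * H] split by type,
    whatever the order of enumeration. *)
Definition fun_mx (f : T -> T -> F) : 'M[F]_#|T| :=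
  \matrix_(i, j) f (enum_val i) (enum_val j).

Lemma sum_enum_val (V : nmodType) (f : T -> V) :
  \sum_x f x = \sum_(i < #|T|) f (enum_val i).
Proof. exact: (big_enum_val (A := T) f). Qed.

Lemma eq_fun_mx (f g : T -> T -> F) : f =2 g -> fun_mx f = fun_mx g.
Proof. by move=> fg; apply/matrixP => i j; rewrite !mxE fg. Qed.

Lemma fun_mx_inj (f g : T -> T -> F) : fun_mx f = fun_mx g -> f =2 g.
Proof.
move=> /matrixP fg x y; have := fg (enum_rank x) (enum_rank y).
by rewrite !mxE !enum_rankK.
Qed.

Lemma mul_fun_mx (f g : T -> T -> F) :
  fun_mx f *m fun_mx g = fun_mx (fun x z => \sum_y f x y * g y z).
Proof.
apply/matrixP => i j; rewrite !mxE sum_enum_val.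
by apply: eq_bigr => k _; rewrite !mxE.
Qed.

Lemma fun_mx_rank (A : 'M[F]_#|T|) :
  fun_mx (fun x y => A (enum_rank x) (enum_rank y)) = A.
Proof. by apply/matrixP => i j; rewrite !mxE !enum_valK. Qed.

Lemma fun_mx1 : fun_mx (fun x y => (x == y)%:R) = 1%:M.
Proof. by apply/matrixP => i j; rewrite !mxE (inj_eq enum_val_inj). Qed.

(** The rows of [V] are left eigenvectors and [W] is the inverse of [V], so [f] is conjugate to a
    diagonal matrix. *)
Lemma char_poly_fun_mx (f V W : T -> T -> F) (d : T -> F) :
  (forall x z, \sum_y V x y * W y z = (x == z)%:R) ->
  (forall x z, \sum_y V x y * f y z = d x * V x z) ->
  char_poly (fun_mx f) = \prod_x ('X - (d x)%:P).
Proof.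
move=> VW Vf.
have VW1 : fun_mx V *m fun_mx W = 1%:M.
  by rewrite mul_fun_mx -fun_mx1; apply: eq_fun_mx.
have [Vu Wu] := mulmx1_unit VW1.
pose D := diag_mx (\row_(i < #|T|) d (enum_val i)).
have VfD : fun_mx V *m fun_mx f = D *m fun_mx V.
  rewrite mul_fun_mx; apply/matrixP => i j.
  by rewrite mul_diag_mx !mxE Vf.
have -> : fun_mx f = invmx (fun_mx V) *m D *m fun_mx V.
  by rewrite -mulmxA -VfD mulmxA mulVmx // mul1mx.
rewrite char_poly_conj // char_poly_trig ?diag_mx_is_trig //.
rewrite [RHS](big_enum_val (A := T)).
by apply: eq_bigr => i _; rewrite !mxE eqxx.
Qed.

End FunctionMatrices.

(** * Laplacian entries of unions and products *)

Section LaplacianEntries.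

Definition lap (F : pzRingType) (G : sgraph) (x y : G) : F :=
  (degree x)%:R * (x == y)%:R - (edge x y)%:R.

Lemma degreeE (F : pzRingType) (G : sgraph) (x : G) :
  (degree x)%:R = \sum_y (edge x y)%:R :> F.
Proof.
rewrite /degree -sum1dep_card natr_sum big_mkcond /=.
by apply: eq_bigr => y _; case: edge.
Qed.

Lemma laplacian_fun_mx (R : rcfType) (G : sgraph) :
  laplacian_mx R G = fun_mx (@lap R G).
Proof.
apply/matrixP => i j; rewrite !mxE /lap (inj_eq enum_val_inj).
by rewrite mulr_natr.
Qed.

(** The Laplacian as a difference operator: the degree at [z] is absorbed as one copy of [v z] per
    neighbour. *)
Lemma sum_lap (F : comPzRingType) (G : sgraph) (v : G -> F) (z : G) :
  \sum_y v y * lap F y z = \sum_y (edge y z)%:R * (v z - v y).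
Proof.
under eq_bigr do rewrite mulrBr.
under [RHS]eq_bigr do rewrite mulrBr.
rewrite !sumrB; congr (_ - _); last by apply: eq_bigr => y _; rewrite mulrC.
rewrite (bigD1 z) //= eqxx mulr1 big1 ?addr0 => [|y /negPf->]; last first.
  by rewrite !mulr0.
rewrite degreeE mulr_sumr; apply: eq_bigr => y _.
by rewrite mulrC edge_sym.
Qed.

Lemma dunion_degree_inl (G H : sgraph) (x : G) :
  degree (inl x : dunion G H) = degree x.
Proof.
apply/eqP; rewrite -(eqr_nat rat) !degreeE big_sumType /=.
by rewrite [X in _ + X]big1 ?addr0.
Qed.

Lemma dunion_degree_inr (G H : sgraph) (y : H) :
  degree (inr y : dunion G H) = degree y.
Proof.
apply/eqP; rewrite -(eqr_nat rat) !degreeE big_sumType /=.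
by rewrite [X in X + _]big1 ?add0r.
Qed.

(** The two kinds of adjacency exclude each other by irreflexivity, so the disjunction becomes a
    sum. *)
Lemma cartesian_edgeE (F : pzRingType) (G H : sgraph)
    (u v : cartesian G H) :
  (edge u v)%:R = (u.1 == v.1)%:R * (edge u.2 v.2)%:R
                  + (edge u.1 v.1)%:R * (u.2 == v.2)%:R :> F.
Proof.
case: u v => [a b] [c d] /=; rewrite /cartesian_rel /=.
have [<-|_] := eqVneq a c; have [<-|_] := eqVneq b d;
  by rewrite ?edge_irr ?mul1r ?mul0r ?mulr1 ?mulr0 ?addr0 ?add0r ?orbF ?andbT.
Qed.

Lemma sum_delta (F : pzRingType) (T : finType) (a : T) (f : T -> F) :
  \sum_x (a == x)%:R * f x = f a.
Proof.
rewrite (bigD1 a) //= eqxx mul1r big1 ?addr0 // => x.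
by rewrite eq_sym => /negPf->; rewrite mul0r.
Qed.

Lemma sum_deltar (F : pzRingType) (T : finType) (a : T) (f : T -> F) :
  \sum_x f x * (a == x)%:R = f a.
Proof.
by rewrite -[RHS](sum_delta a f); apply: eq_bigr => x _; rewrite -commr_nat.
Qed.

Lemma cartesian_degree (G H : sgraph) (u : cartesian G H) :
  degree u = (degree u.1 + degree u.2)%N.
Proof.
apply/eqP; rewrite -(eqr_nat rat) natrD !degreeE.
under eq_bigr do rewrite cartesian_edgeE.
rewrite big_split /= addrC; apply/eqP.
rewrite -(pair_bigA _ (fun a b => (edge u.1 a)%:R * (u.2 == b)%:R)) /=.
rewrite -(pair_bigA _ (fun a b => (u.1 == a)%:R * (edge u.2 b)%:R)) /=.
congr (_ + _).
  by apply: eq_bigr => a _; rewrite sum_deltar.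
under eq_bigr do rewrite -mulr_sumr.
exact: sum_delta.
Qed.

(** The Kronecker sum of the two Laplacians, $L(G) \otimes I + I \otimes L(H)$. *)
Lemma lap_cartesian (F : comPzRingType) (G H : sgraph)
    (u v : cartesian G H) :
  lap F u v = lap F u.1 v.1 * (u.2 == v.2)%:R
              + (u.1 == v.1)%:R * lap F u.2 v.2.
Proof.
rewrite /lap cartesian_degree cartesian_edgeE natrD.
have -> : (u == v) = (u.1 == v.1) && (u.2 == v.2) by [].
by rewrite -mulnb natrM; ring.
Qed.

End LaplacianEntries.

(** * Counting edges by degrees *)

Section EdgeCount.

Lemma set2_eq (T : finType) (a b c d : T) :
  ([set a; b] == [set c; d]) = ((a, b) \in [set (c, d); (d, c)]).
Proof.
rewrite !inE !xpair_eqE; apply/eqP/idP => [E|]; last first.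
  by case/orP => /andP[/eqP-> /eqP->] //; rewrite setUC.
have := set21 a b; have := set22 a b; rewrite E !inE.
have := set21 c d; have := set22 c d; rewrite -E !inE.
by do 4![case/orP => /eqP ?; subst]; rewrite ?eqxx ?orbT.
Qed.

(** Ordered adjacent pairs are counted twice over: by first end, and by underlying edge, where each
    fibre has two elements. *)
Lemma handshake (G : sgraph) : (\sum_(x : G) degree x = 2 * #|edges G|)%N.
Proof.
transitivity #|[set u : G * G | edge u.1 u.2]|.
  rewrite -sum1dep_card [RHS]big_mkcond /=.
  rewrite -(pair_bigA _ (fun x y => if edge x y then 1 else 0)%N) /=.
  by apply: eq_bigr => x _; rewrite -big_mkcond sum1dep_card.
rewrite -sum1_card (partition_big_imset (fun u => [set u.1; u.2])) /=.
have -> : [set [set u.1; u.2] | u in [set u : G * G | edge u.1 u.2]] = edges G.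
  by apply/setP => e; apply/imsetP/imsetP => -[u ue ->]; exists u;
    rewrite // inE in ue *.
rewrite mulnC -sum_nat_const; apply: eq_bigr => e /imsetP[[a b]].
rewrite inE /= => ab ->.
have ab' : a != b by apply: contraTneq ab => ->; rewrite edge_irr.
rewrite sum1dep_card.
have -> : #|[set u : G * G | (u \in [set u | edge u.1 u.2]) &&
              ([set u.1; u.2] == [set a; b])]| = #|[set (a, b); (b, a)]|.
  apply: eq_card => -[c d]; rewrite !inE /= set2_eq !inE.
  apply/andP/idP => [[] //|E]; split => //.
  by case/orP: E => /eqP[-> ->] //; rewrite edge_sym.
by rewrite cards2 xpair_eqE (negPf ab').
Qed.

Lemma dunion_edges (G H : sgraph) :
  (2 * #|edges (dunion G H)| = 2 * #|edges G| + 2 * #|edges H|)%N.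
Proof.
rewrite -!handshake big_sumType /=; congr (_ + _)%N; apply: eq_bigr => x _.
  exact: dunion_degree_inl.
exact: dunion_degree_inr.
Qed.

Lemma cartesian_edges (G H : sgraph) :
  (2 * #|edges (cartesian G H)|
   = #|H| * (2 * #|edges G|) + #|G| * (2 * #|edges H|))%N.
Proof.
rewrite -!handshake; under eq_bigr do rewrite cartesian_degree.
rewrite -(pair_bigA _ (fun a b => degree a + degree b)%N) /=.
under eq_bigr do rewrite big_split sum_nat_const /=.
by rewrite big_split sum_nat_const -big_distrr.
Qed.

Lemma edgeless_edges (p : nat) : #|edges (edgeless p)| = 0%N.
Proof.
apply/eqP; rewrite cards_eq0; apply/eqP/setP => e; rewrite inE.
by apply/negP => /imsetP[u]; rewrite inE.
Qed.

Lemma complete_edges (p : nat) : (2 * #|edges (complete p)| = p * p.-1)%N.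
Proof.
rewrite -handshake (eq_bigr (fun=> p.-1)) ?sum_nat_const ?card_ord // => x _.
rewrite /degree -[in RHS](card_ord p) -(cardsC1 x) /=.
by apply: eq_card => y; rewrite !inE eq_sym.
Qed.

End EdgeCount.

(** * Eigenbases and their behaviour under union and product *)

Section Spectrum.
Variable R : rcfType.
Implicit Types G H K : sgraph.

(* [d] enumerates the eigenvalues of a basis of eigenvectors, the rows of [V]; *)
(* they are taken over [R[i]], where the spectral theorem is available.        *)
Definition eigenbasis G (d : G -> R) : Prop :=
  exists V W : G -> G -> R[i],
    (forall x z, \sum_y V x y * W y z = (x == z)%:R) /\
    (forall x z, \sum_y V x y * lap _ y z = (d x)%:C%C * V x z).

Lemma map_laplacian_mx G :
  map_mx (real_complex R) (laplacian_mx R G) = fun_mx (@lap R[i] G).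
Proof.
rewrite laplacian_fun_mx; apply/matrixP => i j; rewrite !mxE /lap.
by rewrite rmorphB rmorphM /= !rmorph_nat.
Qed.

(** The real symmetric Laplacian is Hermitian over [R[i]], hence unitarily diagonalizable with real
    eigenvalues. Vertices serve as arbitrary labels for them. *)
Lemma eigenbasis_exists G : exists d : G -> R, eigenbasis d.
Proof.
set B := map_mx (real_complex R) (laplacian_mx R G).
have Bherm : B \is hermsymmx.
  apply: realsym_hermsym.
    by apply/is_hermitianmxP; rewrite expr0 scale1r map_mx_id // /B map_trmx
      laplacian_mx_sym.
  by apply/mxOverP => i j; rewrite mxE; apply/complex_realP; eexists.
have [/orthomx_spectralP Beq Dreal] :=
  (hermitian_normalmx Bherm, hermitian_spectral_diag_real Bherm).
set P := spectralmx B in Beq; set D := spectral_diag B in Beq Dreal.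
have Pu : P \in unitmx := spectral_unit B.
exists (fun x => complex.Re (D 0 (enum_rank x))).
exists (fun x y => P (enum_rank x) (enum_rank y)).
exists (fun x y => invmx P (enum_rank x) (enum_rank y)); split.
  apply: fun_mx_inj; rewrite -mul_fun_mx !fun_mx_rank mulmxV //.
  by rewrite fun_mx1.
apply: fun_mx_inj; rewrite -mul_fun_mx fun_mx_rank -map_laplacian_mx -/B.
rewrite Beq !mulmxA mulmxV // mul1mx mul_diag_mx.
apply/matrixP => i j; rewrite !mxE !enum_valK; congr (_ * _).
by have /mxOverP/(_ 0 i)/complex_realP[r ->] := Dreal.
Qed.

Lemma eigenbasis_spectrum G (d : G -> R) :
  eigenbasis d -> perm_eq (laplacian_spectrum R G) [seq d x | x : G].
Proof.
move=> [V [W [VW Vd]]]; apply: perm_laplacian_spectrum.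
apply: (map_poly_inj (real_complex R)).
rewrite map_char_poly map_laplacian_mx.
rewrite (char_poly_fun_mx VW Vd) rmorph_prod /= big_map big_enum /=.
by apply: eq_bigr => x _; rewrite rmorphB /= map_polyX map_polyC.
Qed.

(** Eigenvectors are extended by zero: all matrices involved are block diagonal. *)
Lemma eigenbasis_dunion G H (d : G -> R) (e : H -> R) :
  eigenbasis d -> eigenbasis e ->
  eigenbasis (G := dunion G H)
    (fun s => match s with inl x => d x | inr y => e y end).
Proof.
move=> [V [W [VW Vd]]] [V' [W' [VW' Vd']]].
pose blk (A : G -> G -> R[i]) (B : H -> H -> R[i]) (s t : G + H) :=
  match s, t with
  | inl x, inl y => A x y | inr x, inr y => B x y | _, _ => 0 end.
have blkM A A' B B' s t : \sum_u blk A B s u * blk A' B' u t =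
    blk (fun x z => \sum_y A x y * A' y z)
        (fun x z => \sum_y B x y * B' y z) s t.
  rewrite big_sumType /=; case: s t => [x|x] [z|z] /=.
  - by rewrite [X in _ + X]big1 ?addr0 // => y _; rewrite mul0r.
  - by rewrite !big1 ?addr0 // => y _; rewrite (mulr0, mul0r).
  - by rewrite !big1 ?addr0 // => y _; rewrite (mulr0, mul0r).
  - by rewrite [X in X + _]big1 ?add0r // => y _; rewrite mul0r.
have lapE s t : lap R[i] (s : dunion G H) t = blk (@lap _ G) (@lap _ H) s t.
  rewrite /lap; case: s t => [x|x] [z|z] /=; rewrite ?mulr0 ?subr0 //.
    by rewrite dunion_degree_inl.
  by rewrite dunion_degree_inr.
exists (blk V V'), (blk W W'); split=> s t.
  by rewrite blkM; case: s t => [x|x] [z|z] /=.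
under eq_bigr do rewrite lapE.
by rewrite blkM; case: s t => [x|x] [z|z] /=; rewrite ?mulr0.
Qed.

(** Tensor products of eigenvectors are eigenvectors of the Kronecker sum, and their eigenvalues
    add. *)
Lemma eigenbasis_cartesian G H (d : G -> R) (e : H -> R) :
  eigenbasis d -> eigenbasis e ->
  eigenbasis (G := cartesian G H) (fun u => d u.1 + e u.2).
Proof.
move=> [V [W [VW Vd]]] [V' [W' [VW' Vd']]].
have tensM (f : G -> R[i]) (g : H -> R[i]) :
    \sum_(w : G * H) f w.1 * g w.2 = (\sum_x f x) * (\sum_y g y).
  rewrite mulr_suml -(pair_bigA _ (fun a b => f a * g b)) /=.
  by apply: eq_bigr => x _; rewrite mulr_sumr.
exists (fun u v => V u.1 v.1 * V' u.2 v.2).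
exists (fun u v => W u.1 v.1 * W' u.2 v.2); split=> u v.
  under eq_bigr do rewrite mulrACA.
  rewrite (tensM (fun a => V u.1 a * W a v.1) (fun b => V' u.2 b * W' b v.2)).
  by rewrite VW VW' -natrM mulnb.
have -> : \sum_(w : cartesian G H) V u.1 w.1 * V' u.2 w.2 * lap R[i] w v =
  \sum_(w : G * H) (V u.1 w.1 * lap _ w.1 v.1) * (V' u.2 w.2 * (v.2 == w.2)%:R)
  + \sum_(w : G * H) (V u.1 w.1 * (v.1 == w.1)%:R) * (V' u.2 w.2 * lap _ w.2 v.2).
  rewrite -big_split /=; apply: eq_bigr => w _.
  by rewrite lap_cartesian (eq_sym w.1) (eq_sym w.2); ring.
rewrite (tensM (fun a => V u.1 a * lap _ a v.1)
               (fun b => V' u.2 b * (v.2 == b)%:R)).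
rewrite (tensM (fun a => V u.1 a * (v.1 == a)%:R)
               (fun b => V' u.2 b * lap _ b v.2)).
rewrite Vd Vd'.
rewrite !sum_deltar rmorphD /=; ring.
Qed.

(** * Trace and location of the eigenvalues *)

Lemma spectrumP G (x : R) :
  reflect (exists2 v : G -> R, exists z, v z != 0 &
             forall z, \sum_y (edge y z)%:R * (v z - v y) = x * v z)
          (x \in laplacian_spectrum R G).
Proof.
rewrite -root_prod_XsubC -char_poly_laplacian -eigenvalue_root_char.
apply: (iffP eigenvalueP) => [[r rL r0]|[v [z vz] vL]].
  exists (fun y => r 0 (enum_rank y)).
    have /rV0Pn[i ri] := r0; exists (enum_val i); by rewrite enum_valK.
  move=> z; have /rowP/(_ (enum_rank z)) := rL; rewrite !mxE => <-.
  rewrite -sum_lap sum_enum_val; apply: eq_bigr => i _.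
  by rewrite laplacian_fun_mx !mxE enum_rankK enum_valK.
exists (\row_i v (enum_val i)).
  apply/rowP => i; rewrite !mxE -vL -sum_lap [RHS]sum_enum_val.
  by apply: eq_bigr => j _; rewrite laplacian_fun_mx !mxE.
by apply/rV0Pn; exists (enum_rank z); rewrite mxE enum_rankK.
Qed.

Lemma size_spectrum G : size (laplacian_spectrum R G) = #|G|.
Proof.
apply: succn_inj; rewrite -(size_char_poly (laplacian_mx R G)).
by rewrite char_poly_laplacian size_prod_XsubC.
Qed.

Lemma sum_spectrum G :
  \sum_(x <- laplacian_spectrum R G) x = (2 * #|edges G|)%:R.
Proof.
have [G0|Gpos] := posnP #|G|.
  have /size0nil-> : size (laplacian_spectrum R G) = 0%N.
    by rewrite size_spectrum.
  by rewrite -handshake big_nil big_pred0 // => x; have := card0_eq G0 x.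
(* Both sides, negated, are the subleading coefficient of the characteristic polynomial. *)
apply: oppr_inj; rewrite -coefPn_prod_XsubC ?size_spectrum -?lt0n //.
rewrite -char_poly_laplacian char_poly_trace //; congr (- _).
rewrite -handshake natr_sum sum_enum_val; apply: eq_bigr => i _.
by rewrite laplacian_fun_mx mxE /lap eqxx edge_irr mulr1 subr0.
Qed.

Lemma spectrum0 G : (0 < #|G|)%N -> 0 \in laplacian_spectrum R G.
Proof.
move=> /card_gt0P[z _]; apply/spectrumP; exists (fun=> 1).
  by exists z; rewrite oner_eq0.
by move=> y; rewrite mul0r big1 // => x _; rewrite subrr mulr0.
Qed.

(** Exchanging [y] and [z] and averaging turns the form into half a weighted sum of squares. *)
Lemma quad_form_ge0 (T : finType) (w : T -> T -> R) (v : T -> R) :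
  (forall y z, 0 <= w y z) -> (forall y z, w y z = w z y) ->
  0 <= \sum_z \sum_y w y z * (v z - v y) * v z.
Proof.
move=> w0 wC; set S := \sum_z _.
have SE : S + S = \sum_z \sum_y w y z * (v z - v y) ^+ 2.
  rewrite {2}/S exchange_big /= /S -big_split /=; apply: eq_bigr => z _.
  rewrite -big_split /=; apply: eq_bigr => y _.
  by rewrite (wC z y); ring.
have : 0 <= S + S.
  rewrite SE; apply: sumr_ge0 => z _; apply: sumr_ge0 => y _.
  by rewrite mulr_ge0 ?sqr_ge0.
lra.
Qed.

(* The quadratic form of [L(G)] is bounded by that of the complete graph. *)
Lemma spectrum_le_card G (x : R) :
  x \in laplacian_spectrum R G -> x <= #|G|%:R.
Proof.
case/spectrumP => v [z0 vz0] vL.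
pose S := \sum_z v z ^+ 2.
have S0 : 0 < S.
  rewrite /S (bigD1 z0) //= ltr_pwDl ?sumr_ge0 // => [|z _].
    by rewrite exprn_even_gt0.
  exact: sqr_ge0.
have /quad_form_ge0 - /(_ v) : forall y z : G, 0 <= 1 - (edge y z)%:R :> R.
  by move=> y z; case: edge; rewrite ?subrr ?subr0.
move=> /(_ (fun y z => congr1 (fun b : bool => 1 - b%:R) (edge_sym y z))).
(* This is the form of the complement graph; the weights 1 on the diagonal multiply [v z - v z]. *)
have -> : \sum_z \sum_y (1 - (edge y z)%:R) * (v z - v y) * v z
    = #|G|%:R * S - (\sum_z v z) ^+ 2 - x * S.
  transitivity (\sum_z (#|G|%:R * v z ^+ 2 - (\sum_y v y) * v z
                        - x * v z ^+ 2)).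
    apply: eq_bigr => z _; rewrite -mulr_suml.
    under eq_bigr do rewrite mulrBl mul1r.
    rewrite sumrB vL sumrB sumr_const -mulr_natl; ring.
  by rewrite !sumrB -!mulr_sumr expr2.
have := sqr_ge0 (\sum_z v z); move: (_ ^+ 2) => q q0 h.
by rewrite -(ler_pM2r S0); lra.
Qed.

Lemma spectrum_complete (p : nat) (x : R) :
  x \in laplacian_spectrum R (complete p) -> x = 0 \/ x = p%:R.
Proof.
case/spectrumP => v [z0 vz0] vL.
set S := \sum_z v z.
have vS z : p%:R * v z - S = x * v z.
  have <- : \sum_(y : complete p) v z = p%:R * v z.
    by rewrite sumr_const card_ord mulr_natl.
  rewrite -vL /S -sumrB; apply: eq_bigr => y _ /=.
  by have [->|_] := eqVneq y z; rewrite ?subrr ?mulr0 ?mul1r.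
(* Summing [vS] over all [z] cancels the left-hand side. Where [S] vanishes, [vS] reads
   [p v = x v]. *)
have xS : x * S = 0.
  rewrite mulr_sumr; under eq_bigr do rewrite -vS.
  by rewrite sumrB -mulr_sumr sumr_const card_ord mulr_natl subrr.
have /eqP := xS; rewrite mulf_eq0 => /orP[/eqP->|/eqP S0]; first by left.
right; apply: (mulIf vz0); by rewrite -vS S0 subr0.
Qed.

(** * Sums of distances to the spectrum, and the energy *)

Lemma sumr_const_seq (I : Type) (r : seq I) (x : R) :
  \sum_(i <- r) x = x *+ size r.
Proof. by rewrite big_const_seq count_predT iter_addr_0. Qed.

Lemma spectrum_rcons G (c : R) :
  (1 < #|G|)%N -> 0 <= c -> c < laplacian_eig R G #|G|.-1 ->
  exists2 s, laplacian_spectrum R G = rcons s 0 & {in s, forall x, c < x}.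
Proof.
rewrite /laplacian_eig => G1 c0.
have := spectrum0 (ltnW G1); have := size_spectrum G.
have : sorted >=%R (laplacian_spectrum R G).
  by apply: sort_sorted => x y; rewrite le_total.
case/lastP: (laplacian_spectrum R G) => [|s y] // ss sz s0.
move: sz; rewrite size_rcons => /(congr1 predn) /= sz.
(* [laplacian_eig] counts from 1, so the eigenvalue in [clt] sits at position [#|G|.-2], the last of
   [s] and hence its least entry. *)
have s2 : (#|G|.-2 < size s)%N by rewrite sz; case: #|G| G1 => [|[]].
rewrite nth_rcons s2 => clt.
have sc : {in s, forall x, c < x}.
  move=> x /(nthP 0)[i si <-]; apply: lt_le_trans clt _.
  have ge_trans : transitive (>=%R : rel R) by move=> ? ? ? /[swap]; apply: le_trans.
  move: ss; rewrite -cats1 => /cat_sorted2[ss _].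
  apply: (sorted_leq_nth ge_trans (@lexx _ R) 0 ss) => //.
  by rewrite -ltnS; move: si; rewrite sz; case: #|G| G1 => [|[]].
(* 0 is an eigenvalue but cannot lie in [s], whose entries exceed [c >= 0]; so it is the final
   entry. *)
exists s => //; move: s0; rewrite mem_rcons inE => /orP[/eqP<-//|/sc].
by rewrite ltNge c0.
Qed.

Lemma sum_dist_spectrum_above G (a : R) :
  #|G|%:R <= a ->
  \sum_(x <- laplacian_spectrum R G) `|x - a| =
  #|G|%:R * a - (2 * #|edges G|)%:R.
Proof.
move=> Ga; rewrite -sum_spectrum -(size_spectrum G).
rewrite mulr_natl -sumr_const_seq -sumrB; apply: eq_big_seq => x /spectrum_le_card xG.
by rewrite ler0_norm ?opprB // subr_le0 (le_trans xG).
Qed.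

(** Every eigenvalue but the final 0 exceeds [c >= - b], so its absolute value drops; the 0
    contributes [|b|]. *)
Lemma sum_dist_spectrum_gap G (c b : R) :
  (1 < #|G|)%N -> 0 <= c -> c < laplacian_eig R G #|G|.-1 -> 0 <= b + c ->
  \sum_(x <- laplacian_spectrum R G) `|x + b| =
  (2 * #|edges G|)%:R + #|G|.-1%:R * b + `|b|.
Proof.
move=> G1 c0 cG bc; have [s sE sc] := spectrum_rcons G1 c0 cG.
have sz := size_spectrum G; rewrite sE size_rcons in sz.
rewrite -sum_spectrum -sz sE !big_rcons /= addr0 add0r; congr (_ + _).
rewrite mulr_natl -sumr_const_seq -big_split /=.
apply: eq_big_seq => x /sc cx; rewrite ger0_norm //; lra.
Qed.

Lemma energy_cartesian_dunion G H K (d : H -> R) (e : K -> R) (a : R) :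
  eigenbasis d -> eigenbasis e ->
  (2 * #|edges (cartesian (dunion G H) K)|)%:R
    / #|cartesian (dunion G H) K|%:R = a ->
  laplacian_energy R (cartesian (dunion G H) K) =
  \sum_k (\sum_(x <- laplacian_spectrum R G) `|x + e k - a|
          + \sum_y `|d y + e k - a|).
Proof.
move=> dH eK aE; have [g gG] := eigenbasis_exists G.
have QE := eigenbasis_spectrum (eigenbasis_cartesian (eigenbasis_dunion gG dH) eK).
rewrite /laplacian_energy aE (perm_big _ QE) /= big_map big_enum /=.
rewrite -(pair_bigA _ (fun s k =>
  `|match s with inl x => g x | inr y => d y end + e k - a|)) /=.
rewrite exchange_big /=; apply: eq_bigr => k _.
rewrite big_sumType /=; congr (_ + _).
by rewrite (perm_big _ (eigenbasis_spectrum gG)) /= big_map big_enum.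
Qed.

End Spectrum.

(** * The equality of energies *)

Theorem theorem4p1 (R : rcfType) (n m p : nat) (G1 G2 : sgraph)
    (hn : (2 <= n)%N)
    (conn1 : connected G1) (conn2 : connected G2)
    (card1 : #|G1| = n) (card2 : #|G2| = n)
    (size1 : #|edges G1| = m) (size2 : #|edges G2| = m)
    (hp : (n < p)%N)
    (hmin : (2 * m)%:R / (p + n)%:R <
       Num.min (laplacian_eig R G1 n.-1) (laplacian_eig R G2 n.-1)) :
  laplacian_energy R (cartesian (dunion G1 (edgeless p)) (complete p)) =
  laplacian_energy R (cartesian (dunion G2 (edgeless p)) (complete p)).
Proof.
have [d dp] := eigenbasis_exists R (edgeless p).
have [e ep] := eigenbasis_exists R (complete p).
set c := (2 * m)%:R / (p + n)%:R in hmin.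
have p0 : (0 < p)%N by apply: leq_ltn_trans hp.
(* The mean degree: twice the edge count is [p * 2m + (n + p) * p(p - 1)], over [(n + p) * p]
   vertices. *)
have meanE (G : sgraph) : #|G| = n -> #|edges G| = m ->
    (2 * #|edges (cartesian (dunion G (edgeless p)) (complete p))|)%:R
    / #|cartesian (dunion G (edgeless p)) (complete p)|%:R = c + p%:R - 1 :> R.
  move=> cG eG.
  rewrite cartesian_edges dunion_edges complete_edges edgeless_edges eG muln0.
  rewrite card_prod card_sum !card_ord cG addn0 /c -subn1.
  rewrite !natrD !natrM natrB // natrD.
  have p0' : p%:R != 0 :> R by rewrite pnatr_eq0 -lt0n.
  have pn0 : p%:R + n%:R != 0 :> R by rewrite -natrD pnatr_eq0 -lt0n addn_gt0 p0.
  by field; rewrite pn0 p0'.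
rewrite (energy_cartesian_dunion dp ep (meanE _ card1 size1)).
rewrite (energy_cartesian_dunion dp ep (meanE _ card2 size2)).
have c0 : 0 <= c by rewrite divr_ge0.
have np : n%:R <= p%:R - 1 :> R by rewrite lerBrDr natr1 ler_nat.
move: hmin; rewrite lt_min => /andP[c1 c2].
have epE k : e k = 0 \/ e k = p%:R.
  apply: spectrum_complete; rewrite (perm_mem (eigenbasis_spectrum ep)).
  by rewrite map_f ?mem_enum.
(* The contributions of the edgeless part agree term by term. *)
apply: eq_bigr => k _; congr (_ + _).
have [->|->] := epE k.
  under eq_bigr do rewrite addr0.
  under [RHS]eq_bigr do rewrite addr0.
  by rewrite !sum_dist_spectrum_above ?card1 ?card2 ?size1 ?size2 //; lra.
(* At shift [p] the gap lemma is used with [b = 1 - c], so that [b + c = 1]. *)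
have bE (x : R) : x + p%:R - (c + p%:R - 1) = x + (1 - c) by ring.
under eq_bigr do rewrite bE.
under [RHS]eq_bigr do rewrite bE.
rewrite !(@sum_dist_spectrum_gap _ _ c) ?card1 ?card2 ?size1 ?size2 //; lra.
Qed.
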